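(* Let $(\Delta,\mathcal D,\mathbb P)$ be a probability space, $\mathcal X\subseteq\mathbb R^d$, $f:\mathcal X\to\mathbb R$, $g:\mathcal X\to\mathbb R^q$, $b:\Delta\to\mathbb R^q$, and let $\delta_1,\dots,\delta_N$ be independent draws from $(\Delta,\mathcal D,\mathbb P)$. Consider the non-convex additively-uncertain scenario problem $$\min_{x\in\mathcal X} f(x)\quad\text{s.t. } g(x)\le b(\delta_i),\ i=1,\dots,N. \qquad (\mathrm{SP})$$ For any $\mathbb P$, the risk of the possibly sub-optimal (feasible) solution $\hat x_N^\star$ of (SP) satisfies $$\mathbb P^N\{V(\hat x_N^\star)\le\varepsilon\}\ \ge\ 1-\sum_{m=0}^{q-1}\binom{N}{m}\varepsilon^m(1-\varepsilon)^{N-m}$$ for any $\varepsilon\in(0,1)$, where $q$ is the number of components of $g$.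
   Context: Vector inequalities are componentwise, and $N,q\ge1$. No convexity of $\mathcal X$, $f$ or $g$ is assumed. Standing assumption: (SP) is feasible with probability one, for every $N$. A ''possibly sub-optimal solution'' $\hat x_N^\star$ of (SP) is a point of $\mathcal X$, depending on the data-set $(\delta_1,\dots,\delta_N)$, that satisfies all constraints of (SP), not necessarily a minimizer. The risk of $x\in\mathcal X$ is $V(x)=\mathbb P\{\delta\in\Delta:\ g(x)\not\le b(\delta)\}$. $\mathbb P^N$ is the product probability on $(\Delta^N,\mathcal D^{\otimes N})$, the law of $(\delta_1,\dots,\delta_N)$. As is implicit in writing these probabilities, the sets involved are assumed measurable. Convention: $\binom{N}{m}=0$ for $m>N$. *)

(* Defs.v *)
From HB Require Import structures.
From mathcomp Require Import all_boot all_order all_algebra.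
From mathcomp Require Import all_classical all_reals all_analysis.

Set Implicit Arguments.
Unset Strict Implicit.
Unset Printing Implicit Defensive.

Import Order.TTheory GRing.Theory Num.Theory.
Import numFieldNormedType.Exports.

Local Open Scope classical_set_scope.
Local Open Scope ring_scope.

Section product_probability.
Context {d : measure_display} {T : measurableType d} {R : realType}.

Definition tuple_cons (n : nat) (p : T * n.-tuple T) : n.+1.-tuple T :=
  [tuple of p.1 :: p.2].

Lemma measurable_tuple_cons (n : nat) : measurable_fun setT (@tuple_cons n).
Proof. by apply: measurable_cons; [exact: measurable_fst|exact: measurable_snd]. Qed.

HB.instance Definition _ (n : nat) :=
  @isMeasurableFun.Build _ _ _ _ (@tuple_cons n) (@measurable_tuple_cons n).

(* The N-fold product probability on T^N with its product sigma-algebra: P^0 is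
   the point mass at the empty tuple and P^(n+1) is the image of P x P^n under
   the identification of T * T^n with T^(n+1). Lemma [product_probability_box] evaluates it
   on measurable boxes. *)
Fixpoint product_probability (P : probability T R) (N : nat) :
    probability (N.-tuple T) R :=
  match N with
  | 0 => dirac [tuple]
  | n.+1 =>
    distribution (P \x product_probability P n)%E (@tuple_cons n)
  end.

Lemma product_probability_box (P : probability T R) (N : nat)
    (A : 'I_N -> set T) : (forall i, measurable (A i)) ->
  product_probability P N [set w | forall i, A i (tnth w i)] =
  (\prod_(i < N) P (A i))%E.
Proof.
elim: N A => [|n IHn] A mA.
  by rewrite big_ord0 /= diracE mem_set//= => -[].
rewrite big_ord_recl /= /distribution /pushforward.
rewrite [X in product_measure1 _ _ X](_ : _ =
    A ord0 `*` [set w | forall i, A (lift ord0 i) (tnth w i)]); last first.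
  apply/seteqP; split => -[x w] /=.
    move=> h; split; first by have := h ord0; rewrite /tuple_cons /= tnth0.
    by move=> i; have := h (lift ord0 i); rewrite /tuple_cons /= tnthS.
  move=> [h0 h] i; have [j ->|->] := unliftP ord0 i.
    by rewrite tnthS; exact: h.
  by rewrite tnth0.
rewrite product_measure1E//.
  by congr (_ * _)%E; exact: (IHn (fun i => A (lift ord0 i))).
rewrite (_ : [set _ | _] = \bigcap_(i in [set: 'I_n])
    ((@tnth n T ^~ i) @^-1` A (lift ord0 i))).
  apply: fin_bigcap_measurable => // i _.
  by rewrite -[X in measurable X]setTI; exact: measurable_tnth.
by apply/seteqP; split => w /= h i => [_|]; exact: h.
Qed.

End product_probability.

Definition vec_le {R : realType} {q : nat} (u v : 'rV[R]_q) : Prop :=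
  forall j : 'I_q, u ord0 j <= v ord0 j.

Section scenario_program.
Context {R : realType} {n q : nat} {d : measure_display}
  {Delta : measurableType d}.
Context {X : set 'rV[R]_n} (g : X -> 'rV[R]_q) (b : Delta -> 'rV[R]_q).

Definition scenario_feasible (N : nat) (w : N.-tuple Delta) (x : X) : Prop :=
  forall i : 'I_N, vec_le (g x) (b (tnth w i)).

(* A data-dependent point of X that satisfies all the sampled constraints. On
   the data-sets for which no point of X does, it is an arbitrary point of X;
   almost-sure feasibility makes these data-sets negligible. *)
Definition suboptimal_solution (N : nat) (xhat : N.-tuple Delta -> X) : Prop :=
  forall w, (exists x, scenario_feasible w x) -> scenario_feasible w (xhat w).

Definition risk (P : probability Delta R) (x : X) : \bar R :=
  P [set delta | ~ vec_le (g x) (b delta)].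

End scenario_program.

(* Main.v *)
(* The risk of a feasible point is at most the mass of the points [delta] with
   [b_j delta < min_i b_j (delta_i)] for some [j], so it suffices to bound the law of
   the latter. This is done one coordinate at a time, as for Tukey's equivalent blocks:
   sweep the space along [b_1] until the first sample point is met, discard what was
   swept together with that point, and go on with [b_2] and the other [N - 1] points.
   If the sweeps together remove mass more than [eps], then at the moment when mass
   [eps] is swept fewer than [q] points have been met, which suggests the binomial
   bound. To make this rigorous without continuity of the laws, the space is replaced
   by densities (fractional sets), a sweep is cut into slabs of equal small mass, and
   the slabs are summed with a union bound over the index of a point in the slab. *)
From HB Require Import structures.
Require Import Defs.
From mathcomp Require Import all_boot all_order all_algebra.
From mathcomp Require Import all_classical all_reals all_analysis.
From mathcomp Require Import ring lra measurable_realfun.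
Import Order.TTheory GRing.Theory Num.Theory.
Import numFieldNormedType.Exports.
Local Open Scope classical_set_scope.
Local Open Scope ring_scope.

(** * Finite-difference inequalities for the binomial bound *)

(** At [a = 1], [r = 1 - eps] this is the sum in the theorem. The total mass [a] is kept free
    because sweeping changes it. *)
Definition binomial_head {R : realType} (q n : nat) (r a : R) : R :=
  \sum_(m < q) ('C(n, m))%:R * (a - r) ^+ m * r ^+ (n - m).

(* The chance that [n] points, put independently in a set of mass [a], leave fewer
   than [q] of them in a given subset of mass [a - r]; there is no such subset if
   [a < r]. It satisfies [d/da sweep_bound q.+1 n.+1 r a = n.+1 * sweep_bound q n r a]. *)
Definition sweep_bound {R : realType} (q n : nat) (r a : R) : R :=
  if a < r then a ^+ n else binomial_head q n r a.

Section binomial_head_theory.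
Context {R : realType}.
Implicit Types (r a h x : R) (q n m : nat).

(** Bernoulli's inequality in homogeneous form. In the induction, multiplying by [x + h] leaves an
    excess of [m.+1 * h^2 * x^m]. *)
Lemma exprD_ge x h m : 0 <= x -> 0 <= h ->
  x ^+ m.+1 + (m.+1)%:R * h * x ^+ m <= (x + h) ^+ m.+1.
Proof.
move=> x0 h0; elim: m => [|m IH]; first by rewrite !expr1 expr0; lra.
rewrite [leRHS]exprSr; apply: (le_trans _ (ler_wpM2r _ IH)); last lra.
have xm : 0 <= x ^+ m by exact: exprn_ge0.
rewrite !exprS -(natr1 m.+1); set c := m.+1%:R; set y := x ^+ m in xm *.
have c0 : 0 <= c :> R by rewrite ler0n.
rewrite -subr_ge0.
suff -> : (x * y + c * h * y) * (x + h) - (x * (x * y) + (c + 1) * h * (x * y)) =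
  c * h * h * y by rewrite !mulr_ge0.
by ring.
Qed.

Lemma binomial_head_ge0 q n r a : 0 <= r -> r <= a -> 0 <= binomial_head q n r a.
Proof.
move=> r0 ra; apply: sumr_ge0 => m _.
by rewrite !mulr_ge0 ?ler0n ?exprn_ge0 ?subr_ge0.
Qed.

Lemma binomial_head_diag q n r : binomial_head q.+1 n r r = r ^+ n.
Proof.
rewrite /binomial_head big_ord_recl big1 /= => [|m _].
  by rewrite bin0 expr0 subn0 !mul1r addr0.
by rewrite subrr expr0n /= mulr0 mul0r.
Qed.

(** A discrete form of the derivative identity. The terms of index 0 do not depend on [a] and
    cancel; the others are compared one by one, by [(n+1) C(n,m) = (m+1) C(n+1,m+1)] and Bernoulli's
    inequality. *)
Lemma binomial_head_increment q n r a h : 0 <= r -> r <= a -> 0 <= h ->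
  (n.+1)%:R * h * binomial_head q n r a <=
  binomial_head q.+1 n.+1 r (a + h) - binomial_head q.+1 n.+1 r a.
Proof.
move=> r0 ra h0; rewrite /binomial_head.
rewrite [X in _ <= X - _]big_ord_recl [X in _ <= _ - X]big_ord_recl /=.
rewrite !expr0 opprD addrACA subrr add0r -sumrB mulr_sumr; apply: ler_sum => m _.
rewrite /bump /= !add1n subSS -mulrBl -mulrBr.
have -> : n.+1%:R * h * ('C(n, m)%:R * (a - r) ^+ m * r ^+ (n - m)) =
  ('C(n.+1, m.+1))%:R * ((m.+1)%:R * h * (a - r) ^+ m) * r ^+ (n - m).
  have e : n.+1%:R * 'C(n, m)%:R = m.+1%:R * 'C(n.+1, m.+1)%:R :> R.
    by rewrite -!natrM mul_bin_diag.
  transitivity (n.+1%:R * 'C(n, m)%:R * h * (a - r) ^+ m * r ^+ (n - m)).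
    by ring.
  by rewrite e; ring.
rewrite ler_wpM2r ?exprn_ge0// ler_wpM2l ?ler0n//.
rewrite lerBrDl (_ : a + h - r = (a - r) + h); last by ring.
by apply: exprD_ge => //; rewrite subr_ge0.
Qed.

Lemma sweep_bound_ge0 q n r a : 0 <= r -> 0 <= a -> 0 <= sweep_bound q n r a.
Proof.
move=> r0 a0; rewrite /sweep_bound; case: ltP => ra; first exact: exprn_ge0.
exact: binomial_head_ge0.
Qed.

Lemma sweep_bound_increment q n r a h : 0 <= r -> 0 <= a -> 0 <= h ->
  (n.+1)%:R * h * sweep_bound q.+1 n r a <=
  sweep_bound q.+2 n.+1 r (a + h) - sweep_bound q.+2 n.+1 r a.
Proof.
move=> r0 a0 h0; rewrite /sweep_bound; case: (ltP a r) => [ar|ra]; last first.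
  by rewrite ltNge (le_trans ra) ?lerDl//=; exact: binomial_head_increment.
case: ltP => ahr; first by rewrite lerBrDl exprD_ge.
have k0 : 0 <= a + h - r by rewrite subr_ge0.
(* The increment jumps over [r] and is cut there: Bernoulli's inequality from [a] to [r], the
   binomial increment from [r] to [a + h]. The two branches of [sweep_bound] agree at [r]. *)
have := @binomial_head_increment q.+1 n r r _ r0 (lexx r) k0.
rewrite !binomial_head_diag (_ : r + (a + h - r) = a + h); last by ring.
have := @exprD_ge a (r - a) n a0; rewrite (_ : a + (r - a) = r); last by ring.
rewrite subr_ge0 => /(_ (ltW ar)).
have arn : a ^+ n <= r ^+ n by rewrite lerXn2r ?nnegrE// ltW.
have := ler_wpM2l (mulr_ge0 (ler0n R n.+1) k0) arn.
set u := a ^+ n; set v := r ^+ n; set c := n.+1%:R.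
have -> : c * h * u = c * (r - a) * u + c * (a + h - r) * u by ring.
lra.
Qed.

Lemma sweep_bound0 q r a : sweep_bound q.+1 0 r a = 1.
Proof.
rewrite /sweep_bound expr0; case: ifP => // _.
rewrite /binomial_head big_ord_recl big1 => [|m _].
  by rewrite bin0 !expr0 /= !mul1r addr0.
by rewrite bin0n mul0r mul0r.
Qed.

(** The shift leaves [a - r] unchanged, so only the powers of [r] have to converge. *)
Lemma le_binomial_head_lim q n r a (J : R) :
  (forall K : nat,
     J <= binomial_head q n (r + a / K.+1%:R) (a + a / K.+1%:R)) ->
  J <= binomial_head q n r a.
Proof.
move=> H.
have c0 : r + a / K.+1%:R @[K --> \oo] --> r.
  rewrite -[X in _ --> X]addr0 -(mulr0 a).
  apply: cvgD; first exact: cvg_cst.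
  by apply: cvgM; [exact: cvg_cst|exact: cvg_harmonic].
suff /cvgr_to_ge : binomial_head q n (r + a / K.+1%:R) (a + a / K.+1%:R)
    @[K --> \oo] --> binomial_head q n r a.
  by apply; apply: nearW.
rewrite /binomial_head.
apply: cvg_big => [|m _]; first by move=> ?; exact: add_continuous.
apply: cvgM; last first.
  exact: (cvg_comp _ (fun x => x ^+ (n - m)) c0 (@exprn_continuous R (n - m) r)).
apply: cvgM; first exact: cvg_cst.
have -> : (fun K : nat => (a + a / K.+1%:R - (r + a / K.+1%:R)) ^+ m) =
    fun=> (a - r) ^+ m.
  by apply/funext => K; congr (_ ^+ m); ring.
exact: cvg_cst.
Qed.

End binomial_head_theory.

(** * Integration over the product probability, with one coordinate singled out *)

Definition tuple_delete {T : Type} {n : nat} (i : 'I_n.+1) (w : n.+1.-tuple T) :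
  n.-tuple T := [tuple tnth w (lift i j) | j < n].

Section product_probability_integral.
Context {d : measure_display} {T : measurableType d} {R : realType}.
Variable P : probability T R.

Lemma measurable_tuple_delete (n : nat) (i : 'I_n.+1) :
  measurable_fun [set: n.+1.-tuple T] (tuple_delete i).
Proof.
apply/measurable_fun_tnthP => j.
rewrite (_ : _ \o _ = (fun w => tnth w (lift i j))).
  exact: measurable_tnth.
by apply/funext => w /=; rewrite tnth_mktuple.
Qed.

Lemma tuple_delete0 (n : nat) (x : T) (w : n.-tuple T) :
  tuple_delete ord0 (tuple_cons (x, w)) = w.
Proof.
by apply: eq_from_tnth => j; rewrite tnth_mktuple tnthS.
Qed.

Lemma tuple_deleteS (n : nat) (i : 'I_n.+1) (x : T) (w : n.+1.-tuple T) :
  tuple_delete (lift ord0 i) (tuple_cons (x, w)) =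
  tuple_cons (x, tuple_delete i w).
Proof.
apply: eq_from_tnth => j; rewrite tnth_mktuple.
have [k ->|->] := unliftP ord0 j; last first.
  by rewrite (_ : lift (lift ord0 i) _ = ord0) ?tnth0//; apply/val_inj.
rewrite [RHS]tnthS tnth_mktuple.
rewrite (_ : lift (lift ord0 i) _ = lift ord0 (lift i k)) ?tnthS//.
by apply/val_inj; rewrite /= /bump /= !add1n ltnS; case: leqP; rewrite ?addn1// ?addn0.
Qed.

Lemma integral_product_probability0 (f : 0.-tuple T -> \bar R) :
  (\int[product_probability P 0]_w f w = f [tuple])%E.
Proof.
rewrite /= integral_dirac// ?diracE ?mem_set// ?mul1e//.
(* The space of empty tuples is a single point, so every function on it is measurable. *)
move=> _ Y mY; rewrite setTI.
have [h|h] := pselect (Y (f [tuple])).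
  by rewrite (_ : _ @^-1` _ = setT)//; apply/seteqP; split => w // _ /=; rewrite (tuple0 w).
by rewrite (_ : _ @^-1` _ = set0)//; apply/seteqP; split => w //= ; rewrite (tuple0 w).
Qed.

Lemma measurable_tuple_consr (n : nat) (x : T) :
  measurable_fun [set: n.-tuple T] (fun w => tuple_cons (x, w)).
Proof.
by apply: measurableT_comp; [exact: measurable_tuple_cons|exact: measurable_pair1].
Qed.

Lemma integral_product_probabilityS (n : nat) (f : n.+1.-tuple T -> \bar R) :
  measurable_fun [set: n.+1.-tuple T] f -> (forall w, 0 <= f w)%E ->
  (\int[product_probability P n.+1]_w f w =
   \int[P]_x \int[product_probability P n]_w f (tuple_cons (x, w)))%E.
Proof.
move=> mf f0; rewrite /= ge0_integral_distribution//.
rewrite fubini_tonelli1//=.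
by apply: measurableT_comp => //; exact: measurable_tuple_cons.
Qed.

(** Each coordinate is independent of the tuple of the others. As the product is built by adding
    points in front, index 0 is Tonelli's theorem, and a later index is treated by induction with
    the first point held fixed. *)
Lemma integral_product_probability_delete (n : nat) (i : 'I_n.+1)
    (f : T -> \bar R) (F : n.-tuple T -> \bar R) :
  measurable_fun setT f -> (forall x, 0 <= f x)%E ->
  measurable_fun [set: n.-tuple T] F -> (forall w, 0 <= F w)%E ->
  (\int[product_probability P n.+1]_w (f (tnth w i) * F (tuple_delete i w)) =
   (\int[P]_x f x) * \int[product_probability P n]_w F w)%E.
Proof.
move=> mf f0; elim: n i F => [|n IH] i F mF F0.
  rewrite integral_product_probabilityS.
  - rewrite integral_product_probability0 -ge0_integralZr//.
    apply: eq_integral => x _; rewrite integral_product_probability0.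
    by rewrite (ord1 i) tnth0 tuple_delete0.
  - apply: emeasurable_funM; apply: measurableT_comp => //.
      exact: measurable_tnth.
    exact: measurable_tuple_delete.
  - by move=> w; exact: mule_ge0.
have mS (k : 'I_n.+2) : measurable_fun [set: n.+2.-tuple T]
    (fun w : n.+2.-tuple T => f (tnth w k) * F (tuple_delete k w))%E.
  apply: emeasurable_funM; apply: measurableT_comp => //.
    exact: measurable_tnth.
  exact: measurable_tuple_delete.
rewrite integral_product_probabilityS//; last by move=> w; exact: mule_ge0.
have [k ->|->] := unliftP ord0 i; last first.
  rewrite -ge0_integralZr//; last exact: integral_ge0.
  apply: eq_integral => x _; rewrite -ge0_integralZl//.
  by apply: eq_integral => w _; rewrite tnth0 tuple_delete0.
rewrite integral_product_probabilityS// -ge0_integralZl//; last first.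
- exact: integral_ge0.
- by move=> x _; exact: integral_ge0.
- apply: (@measurable_fun_fubini_tonelli_F _ _ _ _ _ (product_probability P n)
    (F \o @tuple_cons _ _ n)) => [|x]; last exact: F0.
  by apply: measurableT_comp => //; exact: measurable_tuple_cons.
apply: eq_integral => x _.
rewrite -(IH k (fun w => F (tuple_cons (x, w))))//.
  by apply: eq_integral => w _; rewrite tnthS tuple_deleteS.
by apply: measurableT_comp => //; exact: measurable_tuple_consr.
Qed.

Lemma measurable_tuple_prod (n : nat) (f : T -> R) : measurable_fun setT f ->
  measurable_fun [set: n.-tuple T] (fun w => \prod_(j < n) f (tnth w j)).
Proof.
move=> mf; apply: measurable_prod => j _.
by apply: measurableT_comp => //; exact: measurable_tnth.
Qed.

Lemma integral_product_probability_prod (n : nat) (f : T -> R) (p : R) :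
  measurable_fun setT f -> (forall x, 0 <= f x) ->
  (\int[P]_x (f x)%:E = p%:E ->
  \int[product_probability P n]_w (\prod_(j < n) f (tnth w j))%:E =
   (p ^+ n)%:E)%E.
Proof.
move=> mf f0 fp; elim: n => [|n IH].
  by rewrite integral_product_probability0 big_ord0.
under eq_integral => w _.
  rewrite big_ord_recl EFinM (_ : \prod_(j < n) _ =
      \prod_(j < n) f (tnth (tuple_delete ord0 w) j)); last first.
    by apply: eq_bigr => j _; rewrite tnth_mktuple.
  over.
rewrite (integral_product_probability_delete _ ord0 (EFin \o f)
  (fun w => (\prod_(j < n) f (tnth w j))%:E)) //=.
- by rewrite fp IH exprS.
- exact/measurable_EFinP.
- by apply/measurable_EFinP; exact: measurable_tuple_prod.
- by move=> w; rewrite lee_fin prodr_ge0.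
Qed.

End product_probability_integral.

(** * Cutting a density at a quantile *)

Section quantile_split.
Context {d : measure_display} {T : measurableType d} {R : realType}.
Variable P : probability T R.

Lemma measurable_true_set (b : T -> bool) :
  measurable_fun [set: T] b -> measurable [set y | b y].
Proof.
move=> mb; rewrite (_ : [set y | _] = [set: T] `&` b @^-1` [set true]); first exact: mb.
by rewrite setTI.
Qed.

Lemma measurable_bool_natr (b : T -> bool) :
  measurable_fun [set: T] b -> measurable_fun [set: T] (fun y => (b y)%:R : R).
Proof.
move=> mb; rewrite (_ : (fun y => _) = fun y => if b y then 1 else 0).
  exact: measurable_fun_ifT.
by apply/funext => y; case: (b y).
Qed.

Lemma integral_mul_indicator (f : T -> R) (b : T -> bool) :
  (\int[P]_y (f y * (b y)%:R)%:E = \int[P]_(y in [set y | b y]) (f y)%:E)%E.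
Proof.
rewrite [RHS]integral_mkcond; apply: eq_integral => y _.
rewrite patchE; case: ifPn => [|]; rewrite ?inE ?notin_setE /=.
  by move=> ->; rewrite mulr1.
by move=> /negP/negbTE ->; rewrite mulr0.
Qed.

(** Monotone convergence, used to exhaust the space and to pass from half-lines to their limits. *)
Lemma integral_bigcup_le (f : T -> \bar R) (F : (set T)^nat) (c : \bar R) :
  measurable_fun [set: T] f -> (forall y, 0 <= f y)%E ->
  {homo F : n m / (n <= m)%N >-> n `<=` m} -> (forall n, measurable (F n)) ->
  (forall n, \int[P]_(y in F n) f y <= c)%E ->
  (\int[P]_(y in \bigcup_n F n) f y <= c)%E.
Proof.
move=> mf f0 ndF mF Fc.
have cvgF : (\int[P]_(y in F n) f y)%E @[n --> \oo] -->
    (\int[P]_(y in \bigcup_n F n) f y)%E.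
  apply: ge0_nondecreasing_set_cvg_integral => //.
  - by move=> n m nm; apply/subsetPset; exact: ndF.
  - by move=> i; exact: measurable_funTS.
rewrite -(cvg_lim _ cvgF)//; apply: lime_le; last exact: nearW.
by apply/cvg_ex; eexists; exact: cvgF.
Qed.

Variables (f h : T -> R).
Hypotheses (mf : measurable_fun [set: T] f) (f0 : forall y, 0 <= f y).
Hypothesis mh : measurable_fun [set: T] h.

Let mEf : measurable_fun [set: T] (EFin \o f).
Proof. exact/measurable_EFinP. Qed.

Let m_ge t : measurable [set y | t <= h y].
Proof. by apply: measurable_true_set; exact: measurable_fun_ler. Qed.

Let m_lt t : measurable [set y | h y < t].
Proof. by apply: measurable_true_set; exact: measurable_fun_ltr. Qed.

Variables (p x : R).
Hypothesis fp : (\int[P]_y (f y)%:E = p%:E)%E.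

Let int_ge_lt t :
  (\int[P]_(y in [set y | (t <= h y)%R]) (f y)%:E +
   \int[P]_(y in [set y | (h y < t)%R]) (f y)%:E = p%:E)%E.
Proof.
rewrite -fp -ge0_integral_setU//=.
- congr (integral _ _ _); apply/seteqP; split => // y _ /=.
  by case: (leP t (h y)); [left|right].
- exact: measurable_funTS.
- by move=> y _; rewrite lee_fin.
- apply/disj_setPS => y /= -[]; rewrite leNgt => /negP ?; exact.
Qed.

(** The quantile is the supremum of the set [S] of thresholds above which [f] has mass at least [x].
    Since [0 < x < p], this set is neither empty nor unbounded above. The first inequality comes
    from thresholds decreasing to the supremum, which lie outside [S], and the second from
    thresholds increasing to it. *)
Lemma exists_quantile : 0 < x < p -> exists t,
  (\int[P]_(y in [set y | (t < h y)%R]) (f y)%:E <= x%:E)%E /\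
  (x%:E <= \int[P]_(y in [set y | (t <= h y)%R]) (f y)%:E)%E.
Proof.
move=> /andP[x0 xp].
have E0 y : (0 <= (EFin \o f) y)%E by rewrite lee_fin.
pose S := [set t | (x%:E <= \int[P]_(y in [set y | (t <= h y)%R]) (f y)%:E)%E].
(* Passing to the complement turns a decreasing intersection into an increasing union. *)
have ltE t : S t <-> (\int[P]_(y in [set y | (h y < t)%R]) (f y)%:E <= (p - x)%:E)%E.
  have := int_ge_lt t; rewrite /S/=.
  set a := integral _ _ _; set b := integral _ _ _.
  have a0 : (0 <= a)%E by apply: integral_ge0 => y _; exact: E0.
  have b0 : (0 <= b)%E by apply: integral_ge0 => y _; exact: E0.
  case: a a0 => [a a0|_|//]; case: b b0 => [b b0|_|//]; rewrite ?addye ?addey//.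
  rewrite -EFinD => -[<-]; rewrite !lee_fin; split; lra.
have Sdown s t : s <= t -> S t -> S s.
  move=> st; rewrite /S /= => /le_trans; apply.
  apply: ge0_subset_integral => //=.
  - exact: measurable_funTS.
  - by move=> y _; exact: E0.
  - by move=> y /=; exact: le_trans.
have [s Ss] : exists s, S s.
  apply: contrapT => /forallNP nS.
  suff : (p%:E <= x%:E)%E by rewrite lee_fin leNgt xp.
  rewrite -fp (_ : setT = \bigcup_n [set y | - n%:R <= h y]); last first.
    apply/seteqP; split => // y _.
    exists (Num.bound `|h y|) => //=.
    rewrite lerNl; apply: le_trans (ler_norm _) _; rewrite normrN.
    by apply/ltW/archi_boundP/normr_ge0.
  apply: integral_bigcup_le => //.
    by move=> n m nm y /=; apply: le_trans; rewrite lerN2 ler_nat.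
  by move=> n; have /negP := nS (- n%:R); rewrite -ltNge => /ltW.
have [u Su] : exists u, ~ S u.
  apply: contrapT => /forallNP nS.
  suff : (p%:E <= (p - x)%:E)%E by rewrite lee_fin; lra.
  rewrite -{1}fp (_ : setT = \bigcup_n [set y | h y < n%:R]); last first.
    apply/seteqP; split => // y _.
    exists (Num.bound `|h y|) => //=.
    by apply: le_lt_trans (ler_norm _) _; apply/archi_boundP/normr_ge0.
  apply: integral_bigcup_le => //.
    by move=> n m nm y /=; move=> /lt_le_trans; apply; rewrite ler_nat.
  by move=> n; apply/ltE; exact: contrapT (nS n%:R).
have ubS v : ~ S v -> ubound S v.
  by move=> nSv w Sw; rewrite leNgt; apply/negP => vw; apply: nSv; exact: Sdown (ltW vw) Sw.
have supS : has_sup S by split; [exists s|exists u; exact: ubS].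
exists (sup S); split.
  rewrite (_ : [set y | _] = \bigcup_n [set y | sup S + n.+1%:R^-1 <= h y]); last first.
    apply/seteqP; split => y /=.
      move=> ty; have [n hn] := ltr_add_invr ty.
      by exists n => //=; exact: ltW.
    by move=> [n _ /=]; apply: lt_le_trans; rewrite ltrDl.
  apply: integral_bigcup_le => //.
    move=> n m nm y /=; apply: le_trans; rewrite lerD2l lef_pV2 ?posrE// ler_nat//.
  move=> n; apply/ltW; rewrite ltNge; apply/negP => Sn.
  have : sup S + n.+1%:R^-1 <= sup S by exact: sup_upper_bound.
  by rewrite gerDl leNgt invr_gt0 ltr0n.
apply/ltE.
rewrite (_ : [set y | _] = \bigcup_n [set y | h y < sup S - n.+1%:R^-1]); last first.
  apply/seteqP; split => y /=.
    move=> ty; have [n hn] := ltr_add_invr ty.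
    by exists n => //=; rewrite ltrBrDr.
  by move=> [n _ /=] /lt_trans; apply; rewrite gtrBl.
apply: integral_bigcup_le => //.
  move=> n m nm y /= /lt_le_trans; apply; rewrite lerD2l lerN2 lef_pV2 ?posrE// ler_nat//.
move=> n; apply/ltE.
have n0 : 0 < n.+1%:R^-1 :> R by rewrite invr_gt0 ltr0n.
have [w Sw ww] := sup_adherent n0 supS.
by apply: Sdown Sw; exact: ltW.
Qed.

(** [f1] takes all of [f] above the quantile [t], nothing below it, and on the level set of [t] just
    the share that makes its mass [x]; [f2] is the rest. Thus an atom at [t] may be divided. *)
Lemma quantile_split : 0 <= x <= p -> exists f1 f2 : T -> R,
  [/\ measurable_fun [set: T] f1, measurable_fun [set: T] f2,
      forall y, 0 <= f1 y, forall y, 0 <= f2 y & forall y, f y = f1 y + f2 y] /\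
  [/\ (\int[P]_y (f1 y)%:E = x%:E)%E, (\int[P]_y (f2 y)%:E = (p - x)%:E)%E &
      forall y z, 0 < f2 y -> 0 < f1 z -> h y <= h z].
Proof.
move=> /andP[x0 xp].
have [->|xN0] := eqVneq x 0.
  exists (fun=> 0), f; split; split => //; rewrite ?subr0//.
  - by move=> y; rewrite add0r.
  - by rewrite integral0.
  - by move=> y z _; rewrite ltxx.
have [->|xNp] := eqVneq x p.
  exists f, (fun=> 0); split; split => //; rewrite ?subrr//.
  - by move=> y; rewrite addr0.
  - by rewrite integral0.
  - by move=> y z; rewrite ltxx.
have [t [Bx xA]] : exists t,
  (\int[P]_(y in [set y | (t < h y)%R]) (f y)%:E <= x%:E)%E /\
  (x%:E <= \int[P]_(y in [set y | (t <= h y)%R]) (f y)%:E)%E.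
  by apply: exists_quantile; rewrite !lt_neqAle eq_sym xN0 x0 xNp.
have restrict (c : T -> bool) : measurable_fun [set: T] c ->
  [/\ measurable_fun [set: T] (fun y => f y * (c y)%:R),
      forall y, 0 <= f y * (c y)%:R &
      exists A : R, (\int[P]_y (f y * (c y)%:R)%:E = A%:E)%E].
  move=> mc.
  have mfc : measurable_fun [set: T] (fun y => f y * (c y)%:R).
    by apply: measurable_funM => //; exact: measurable_bool_natr.
  have fc0 y : 0 <= f y * (c y)%:R by rewrite mulr_ge0.
  split=> //.
  have : (\int[P]_y (f y * (c y)%:R)%:E <= p%:E)%E.
    rewrite -fp; apply: ge0_le_integral => //=.
    - by move=> y _; rewrite lee_fin.
    - exact/measurable_EFinP.
    - by move=> y _; rewrite lee_fin; case: (c y); rewrite ?mulr1 ?mulr0.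
  have : (0 <= \int[P]_y (f y * (c y)%:R)%:E)%E.
    by apply: integral_ge0 => y _; rewrite lee_fin.
  by case: integral => // A _ _; exists A.
pose fA y := f y * (t <= h y)%R%:R; pose fB y := f y * (t < h y)%R%:R.
have [mfA fA0 [A EA]] :
    [/\ measurable_fun [set: T] fA, forall y, 0 <= fA y &
    exists A : R, (\int[P]_y (fA y)%:E = A%:E)%E].
  by apply: restrict; exact: measurable_fun_ler.
have [mfB fB0 [B EB]] :
    [/\ measurable_fun [set: T] fB, forall y, 0 <= fB y &
    exists B : R, (\int[P]_y (fB y)%:E = B%:E)%E].
  by apply: restrict; exact: measurable_fun_ltr.
move: Bx xA; rewrite -!integral_mul_indicator -/fA -/fB EA EB !lee_fin => Bx xA.
(* [th] is the share of [f] given to [f1] where [h = t]. If [A = B], then [B <= x <= A] forces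
   [x = A], and any share will do. *)
have [th th0 [th1 thE]] : exists2 th : R, 0 <= th & th <= 1 /\ th * A + (1 - th) * B = x.
  have [AB|AB] := eqVneq A B.
    by exists 0 => //; split => //; rewrite AB in xA *; lra.
  have AB0 : 0 < A - B by rewrite subr_gt0 lt_neqAle eq_sym AB (le_trans Bx xA).
  exists ((x - B) / (A - B)); first by rewrite divr_ge0 ?(ltW AB0)// subr_ge0.
  split; first by rewrite ler_pdivrMr// mul1r lerD2r.
  by field; rewrite gt_eqF.
have th10 : 0 <= 1 - th by rewrite subr_ge0.
pose f1 y := th * fA y + (1 - th) * fB y.
have mf1 : measurable_fun [set: T] f1.
  by apply: measurable_funD; exact: measurable_funM.
have f10 y : 0 <= f1 y by rewrite addr_ge0// mulr_ge0.
have f1f y : f1 y <= f y.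
  have fy := f0 y; rewrite /f1 /fA /fB.
  case: (ltgtP t (h y)) => /= _; rewrite ?mulr1 ?mulr0; nra.
have mf2 : measurable_fun [set: T] (fun y => f y - f1 y) by exact: measurable_funB.
have f20 y : 0 <= f y - f1 y by rewrite subr_ge0.
have intZ k (g : T -> R) : 0 <= k -> measurable_fun [set: T] g ->
    (forall y, 0 <= g y) ->
    (\int[P]_y (k%:E * (g y)%:E) = k%:E * \int[P]_y (g y)%:E)%E.
  move=> k0 mg g0; apply: ge0_integralZl_EFin => //.
    by move=> y _; rewrite lee_fin.
  exact/measurable_EFinP.
have If1 : (\int[P]_y (f1 y)%:E = x%:E)%E.
  under eq_integral do rewrite /f1 EFinD (EFinM th) (EFinM (1 - th)).
  rewrite ge0_integralD//.
  - rewrite !(intZ _ _ _)// EA EB -!EFinM -EFinD thE//.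
  - by move=> y _; rewrite -EFinM lee_fin mulr_ge0.
  - by apply/measurable_EFinP; exact: measurable_funM.
  - by move=> y _; rewrite -EFinM lee_fin mulr_ge0.
  - by apply/measurable_EFinP; exact: measurable_funM.
exists f1, (fun y => f y - f1 y); split; split => //.
- by move=> y; rewrite addrC subrK.
- have : (\int[P]_y (f y)%:E = x%:E + \int[P]_y (f y - f1 y)%:E)%E.
    rewrite -If1 -ge0_integralD//; last 4 first.
    + by move=> y _; rewrite lee_fin.
    + exact/measurable_EFinP.
    + by move=> y _; rewrite lee_fin.
    + exact/measurable_EFinP.
    by apply: eq_integral => y _; rewrite -EFinD addrC subrK.
  have : (0 <= \int[P]_y (f y - f1 y)%:E)%E by apply: integral_ge0 => y _; rewrite lee_fin.
  rewrite fp; case: integral => // r _; rewrite -EFinD => -[->].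
  by congr EFin; ring.
- move=> y z; rewrite subr_gt0 leNgt => f2y f1z; apply/negP => zy.
  case: (ltP t (h y)) => [ty|yt].
    move: f2y; rewrite /f1 /fA /fB ty (ltW ty) /= !mulr1 -mulrDl addrC subrK.
    by rewrite mul1r ltxx.
  have zt : h z < t by exact: lt_le_trans zy yt.
  move: f1z; rewrite /f1 /fA /fB [t <= h z]leNgt zt [t < h z]ltNge (ltW zt) /=.
  by rewrite !mulr0 addr0 ltxx.
Qed.

End quantile_split.

(** * Points covered by a sample, and their mass *)

Section sweeping.
Context {d : measure_display} {T : measurableType d} {R : realType}.
Variable P : probability T R.
Implicit Types (hs : seq {mfun T >-> R}) (f : T -> R).

(** If [hs] lists the coordinates of [b], a solution feasible for the sample [w] satisfies the
    constraint at every covered point. With [hs] empty, every point is covered. *)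
Definition covered hs (w : seq T) (x : T) : bool :=
  all (fun h : {mfun T >-> R} => has (fun y => h y <= h x) w) hs.

Lemma covered_delete (h : {mfun T >-> R}) hs (n : nat) (i : 'I_n.+1)
    (w : n.+1.-tuple T) (x : T) :
  h (tnth w i) <= h x -> covered hs (tuple_delete i w) x ->
  covered (h :: hs) w x.
Proof.
move=> hix /= cov; apply/andP; split; first by apply/has_tnthP; exists i.
apply: sub_all cov => k /(@has_tnthP _ _ _ (tuple_delete i w))[j].
by rewrite tnth_mktuple => kx; apply/has_tnthP; exists (lift i j).
Qed.

(* [f] plays the role of a fractional subset of mass [p]; fractions are needed to cut
   through the atoms of the laws of the constraints. *)
Definition weight f (p : R) :=
  [/\ measurable_fun [set: T] f, forall x, 0 <= f x &
      (\int[P]_x (f x)%:E = p%:E)%E].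

Definition covered_mass hs f (w : seq T) : \bar R :=
  (\int[P]_x (f x * (covered hs w x)%:R)%:E)%E.

Lemma measurable_has (d' : measure_display) (U : measurableType d') (I : Type)
    (s : seq I) (b : I -> U -> bool) :
  (forall i, measurable_fun [set: U] (b i)) ->
  measurable_fun [set: U] (fun u => has (b ^~ u) s).
Proof.
move=> mb; elim: s => [|i s IH] /=; first exact: measurable_cst.
exact: measurable_or.
Qed.

Lemma measurable_covered (n : nat) hs :
  measurable_fun [set: n.-tuple T * T]
   (fun z => covered hs z.1 z.2).
Proof.
elim: hs => [|h hs IH] /=; first exact: measurable_cst.
apply: measurable_and => //.
(* The search runs over a fixed list of indices instead of the varying tuple, so that measurability
   reduces to single comparisons. *)
rewrite (_ : (fun z => _) = (fun z : n.-tuple T * T =>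
    has (fun j => h (tnth z.1 j) <= h z.2) (enum 'I_n))).
  apply: measurable_has => j; apply: measurable_fun_ler.
    apply: (measurableT_comp (measurable_funPT h)).
    exact: (measurableT_comp (measurable_tnth j) measurable_fst).
  exact: (measurableT_comp (measurable_funPT h) measurable_snd).
apply/funext => -[w x] /=.
by rewrite -[in LHS](map_tnth_enum w) has_map.
Qed.

Lemma measurable_coveredr (n : nat) hs (w : n.-tuple T) :
  measurable_fun [set: T]
   (covered hs w).
Proof.
exact: (measurableT_comp (measurable_covered n hs) (measurable_pair1 w)).
Qed.

Lemma measurable_covered_mass (n : nat) hs f : measurable_fun [set: T] f ->
  (forall x, 0 <= f x) ->
  measurable_fun [set: n.-tuple T] (covered_mass hs f).
Proof.
move=> mf f0.
apply: (@measurable_fun_fubini_tonelli_F _ _ _ _ _ P (fun z : n.-tuple T * T =>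
   (f z.2 * (covered hs z.1 z.2)%:R)%:E)).
  apply/measurable_EFinP; apply: measurable_funM.
    by apply: measurableT_comp => //; exact: measurable_snd.
  by apply: measurable_bool_natr; exact: measurable_covered.
by move=> z; rewrite lee_fin mulr_ge0.
Qed.

(** The [n] points are drawn from the fractional set [f], without normalisation, on the event that
    the covered mass is below [r]. For [f = 1] the integral is the probability of that event. *)
Definition uncovered_integrand hs f (r : R) (n : nat) (w : n.-tuple T) : R :=
  \prod_(j < n) f (tnth w j) * (covered_mass hs f w < r%:E)%E%:R.

Lemma measurable_uncovered_integrand hs f r n : measurable_fun [set: T] f ->
  (forall x, 0 <= f x) ->
  measurable_fun [set: n.-tuple T] (@uncovered_integrand hs f r n).
Proof.
move=> mf f0; apply: measurable_funM; first exact: measurable_tuple_prod.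
apply: measurable_bool_natr; apply: measurable_fun_lte => //.
exact: measurable_covered_mass.
Qed.

Lemma uncovered_integrand_ge0 hs f r n (w : n.-tuple T) :
  (forall x, 0 <= f x) -> 0 <= uncovered_integrand hs f r n w.
Proof. by move=> f0; rewrite mulr_ge0 ?prodr_ge0. Qed.

Definition uncovered_integral hs f (r : R) (n : nat) : \bar R :=
  (\int[product_probability P n]_w (uncovered_integrand hs f r n w)%:E)%E.

Lemma weight_ge0 f p : weight f p -> 0 <= p.
Proof.
move=> [_ f0 fp]; rewrite -lee_fin -fp.
by apply: integral_ge0 => x _; rewrite lee_fin.
Qed.

Lemma uncovered_integral_ge0 hs f r n : (forall x, 0 <= f x) ->
  (0 <= uncovered_integral hs f r n)%E.
Proof.
move=> f0; apply: integral_ge0 => w _.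
by rewrite lee_fin uncovered_integrand_ge0.
Qed.

Lemma uncovered_integral_le_pow hs f p r n : weight f p ->
  (uncovered_integral hs f r n <= (p ^+ n)%:E)%E.
Proof.
move=> [mf f0 fp]; rewrite -(integral_product_probability_prod P n f p mf f0 fp).
apply: ge0_le_integral => //.
- by move=> w _; rewrite lee_fin uncovered_integrand_ge0.
- by apply/measurable_EFinP; exact: measurable_uncovered_integrand.
- by apply/measurable_EFinP; exact: measurable_tuple_prod.
- move=> w _; rewrite lee_fin ler_piMr ?prodr_ge0//.
  by case: (_ < _)%E.
Qed.

Lemma tuple_prod_cons f n x (w : n.-tuple T) :
  \prod_(j < n.+1) f (tnth (tuple_cons (x, w)) j) =
  f x * \prod_(j < n) f (tnth w j).
Proof.
rewrite big_ord_recl tnth0; congr (_ * _).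
by apply: eq_bigr => j _; rewrite tnthS.
Qed.

(** A union bound over the index of a point charged by [f2]: the other points keep the full density
    [f], so tuples with several such points are counted more than once. *)
Lemma tuple_prodD_le (f f1 f2 : T -> R) n (w : n.+1.-tuple T) :
  (forall x, 0 <= f1 x) -> (forall x, 0 <= f2 x) ->
  (forall x, f x = f1 x + f2 x) ->
  \prod_(j < n.+1) f (tnth w j) <= \prod_(j < n.+1) f1 (tnth w j) +
  \sum_(i < n.+1) f2 (tnth w i) * \prod_(j < n) f (tnth (tuple_delete i w) j).
Proof.
move=> f10 f20 fE; have f0 x : 0 <= f x by rewrite fE addr_ge0.
have wE m (v : m.+1.-tuple T) : v = tuple_cons (thead v, [tuple of behead v]).
  by rewrite {1}(tuple_eta v); apply/val_inj.
elim: n w => [|n IH] w; rewrite (wE _ w); move: (thead w) [tuple of behead w] => x v;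
  rewrite !tuple_prod_cons [\sum_(i < _) _]big_ord_recl tnth0 tuple_delete0.
  by rewrite !big_ord0 !mulr1 addr0 fE.
under [X in _ <= _ + (_ + X)]eq_bigr => i _.
  rewrite tnthS tuple_deleteS tuple_prod_cons mulrCA; over.
rewrite -mulr_sumr; have := IH v.
set A := \prod_(j < _) f _; set B := \prod_(j < _) f1 _; set S := \sum_(i < _) _.
move=> ABS; have S0 : 0 <= S.
  by apply: sumr_ge0 => i _; rewrite mulr_ge0// prodr_ge0.
(* The part [f2 x * A] is the summand of index 0. The induction hypothesis is needed only for
   [f1 x * A], where [f1 x <= f x] is then used in front of [S]. *)
rewrite fE; have := f10 x; have := f20 x.
move: (f1 x) (f2 x) => a c c0 a0; nra.
Qed.

(** On the support of [f1] the deleted point already handles [h], so coverage for [hs] by the other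
    points suffices. Elsewhere [f] equals [f2], which costs at most [p2]. *)
Lemma covered_mass_delete (h : {mfun T >-> R}) hs f f1 f2 p1 p2 n (i : 'I_n.+1)
    (w : n.+1.-tuple T) :
  weight f1 p1 -> weight f2 p2 -> (forall x, f x = f1 x + f2 x) ->
  (forall x, 0 < f1 x -> h (tnth w i) <= h x) ->
  (covered_mass hs f (tuple_delete i w) <= covered_mass (h :: hs) f w + p2%:E)%E.
Proof.
move=> [mf1 f10 _] [mf2 f20 <-] fE hi.
have f0 x : 0 <= f x by rewrite fE addr_ge0.
have mf : measurable_fun [set: T] f.
  by rewrite (_ : f = f1 \+ f2); [exact: measurable_funD|apply/funext].
have mcov gs m (v : m.-tuple T) : measurable_fun [set: T] (fun x =>
    (f x * (covered gs v x)%:R)).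
  apply: measurable_funM => //; apply: measurable_bool_natr.
  exact: measurable_coveredr.
rewrite /covered_mass -ge0_integralD//; last 4 first.
- by move=> x _; rewrite lee_fin mulr_ge0.
- by apply/measurable_EFinP; exact: (mcov (h :: hs)).
- by move=> x _; rewrite lee_fin.
- exact/measurable_EFinP.
apply: ge0_le_integral => //.
- by move=> x _; rewrite lee_fin mulr_ge0.
- by apply/measurable_EFinP; exact: (mcov hs).
- apply/measurable_EFinP; apply: measurable_funD => //; exact: (mcov (h :: hs)).
move=> x _; rewrite -EFinD lee_fin.
have [f1x|] := ltP 0 (f1 x).
  case: (boolP (covered hs _ _)) => cov; last first.
    by rewrite mulr0 addr_ge0// mulr_ge0.
  by rewrite [covered _ _ _](covered_delete _ _ _ _ _ _ (hi _ f1x) cov) lerDl.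
move=> f1x; have f1x0 : f1 x = 0 by apply/eqP; rewrite eq_le f1x f10.
rewrite fE f1x0 add0r; apply: (@le_trans _ _ (f2 x)).
  by case: covered; rewrite ?mulr1 ?mulr0.
by rewrite lerDr mulr_ge0.
Qed.

End sweeping.

(** * The binomial bound, by induction on the number of sweeps *)

Section sweeping_bound.
Context {d : measure_display} {T : measurableType d} {R : realType}.
Variable P : probability T R.
Implicit Types (hs : seq {mfun T >-> R}) (f : T -> R).

Lemma weight_split (h : {mfun T >-> R}) f p x : weight P f p -> 0 <= x <= p ->
  exists f1 f2 : T -> R,
  [/\ weight P f1 x, weight P f2 (p - x), forall y, f y = f1 y + f2 y &
      forall y z, 0 < f2 y -> 0 < f1 z -> h y <= h z].
Proof.
move=> [mf f0 fp] xp.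
have [f1 [f2 [[mf1 mf2 f10 f20 fE] [If1 If2 hle]]]] :=
  quantile_split P f h mf f0 (measurable_funPT h) p x fp xp.
by exists f1, f2; split.
Qed.

(* Split at mass [r]: a single sampled point charged by [f2] already covers the
   whole support of [f1], so on the event all points are charged by [f1] only. *)
Lemma uncovered_integral_single (h : {mfun T >-> R}) f p r n :
  weight P f p -> 0 <= r <= p ->
  (uncovered_integral P [:: h] f r n <= (r ^+ n)%:E)%E.
Proof.
move=> wf rp; have [f1 [f2 [wf1 wf2 fE hle]]] := weight_split h f p r wf rp.
have [mf f0 fp] := wf; have [mf1 f10 f1r] := wf1; have [mf2 f20 _] := wf2.
rewrite -(integral_product_probability_prod P n f1 r mf1 f10 f1r).
apply: ge0_le_integral => //.
- by move=> w _; rewrite lee_fin uncovered_integrand_ge0.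
- by apply/measurable_EFinP; exact: measurable_uncovered_integrand.
- by apply/measurable_EFinP; exact: measurable_tuple_prod.
move=> w _; rewrite lee_fin /uncovered_integrand.
have [|] := boolP (_ < _)%E; last by rewrite mulr0 prodr_ge0.
rewrite mulr1 => mass_lt; rewrite le_eqVlt; apply/orP; left; apply/eqP.
apply: eq_bigr => j _; rewrite fE.
have [f2j|] := ltP 0 (f2 (tnth w j)); last first.
  by move=> f2j; rewrite [f2 _](_ : _ = 0) ?addr0//; apply/eqP; rewrite eq_le f2j f20.
exfalso; move: mass_lt; rewrite ltNge => /negP; apply.
rewrite -f1r; apply: ge0_le_integral => //.
- by move=> x _; rewrite lee_fin.
- exact/measurable_EFinP.
- apply/measurable_EFinP; apply: measurable_funM => //.
  by apply: measurable_bool_natr; exact: measurable_coveredr.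
move=> x _; rewrite lee_fin.
have [f1x|f1x] := ltP 0 (f1 x); last by rewrite (le_trans f1x)// mulr_ge0.
rewrite [covered _ _ _](_ : _ = true); first by rewrite mulr1 fE lerDl.
by rewrite /covered /= andbT; apply/has_tnthP; exists j; exact: hle.
Qed.

(* Either all points are charged by [f1], or some point [w_i] is charged by [f2]; in
   the latter case [w_i] takes care of the constraint [h] on the support of [f1], and
   the other points leave mass less than [r + p2] for the constraints [hs]. *)
Lemma uncovered_integral_split (h : {mfun T >-> R}) hs f f1 f2 p1 p2 r n :
  weight P f1 p1 -> weight P f2 p2 -> (forall x, f x = f1 x + f2 x) ->
  (forall y z, 0 < f2 y -> 0 < f1 z -> h y <= h z) ->
  (uncovered_integral P (h :: hs) f r n.+1 <=
   uncovered_integral P (h :: hs) f1 r n.+1 +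
   (n.+1%:R * p2)%:E * uncovered_integral P hs f (r + p2) n)%E.
Proof.
move=> wf1 wf2 fE hle.
have [mf1 f10 _] := wf1; have [mf2 f20 If2] := wf2.
have f0 x : 0 <= f x by rewrite fE addr_ge0.
have mf : measurable_fun [set: T] f.
  by rewrite (_ : f = f1 \+ f2); [exact: measurable_funD|apply/funext].
pose G (i : 'I_n.+1) (w : n.+1.-tuple T) :=
  f2 (tnth w i) * uncovered_integrand P hs f (r + p2) n (tuple_delete i w).
have G0 i w : 0 <= G i w by rewrite mulr_ge0// uncovered_integrand_ge0.
have mG i : measurable_fun [set: n.+1.-tuple T] (G i).
  apply: measurable_funM; first exact: (measurableT_comp mf2 (measurable_tnth i)).
  apply: (measurableT_comp _ (measurable_tuple_delete n i)).
  exact: measurable_uncovered_integrand.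
have IG i : (\int[product_probability P n.+1]_w (G i w)%:E =
    p2%:E * uncovered_integral P hs f (r + p2) n)%E.
  rewrite -If2 -(integral_product_probability_delete P n i (EFin \o f2)
    (fun w => (uncovered_integrand P hs f (r + p2) n w)%:E))//=.
  - exact/measurable_EFinP.
  - by apply/measurable_EFinP; exact: measurable_uncovered_integrand.
  - by move=> w; rewrite lee_fin uncovered_integrand_ge0.
have -> : ((n.+1%:R * p2)%:E * uncovered_integral P hs f (r + p2) n =
    \sum_(i < n.+1) \int[product_probability P n.+1]_w (G i w)%:E)%E.
  under eq_bigr => i _ do rewrite IG.
  by rewrite sumr_const card_ord EFinM -muleA mule_natl.
rewrite -ge0_integral_sum//; last 2 first.
- by move=> i; exact/measurable_EFinP.
- by move=> i w _; rewrite lee_fin.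
rewrite -ge0_integralD//; last 4 first.
- by move=> w _; rewrite lee_fin uncovered_integrand_ge0.
- by apply/measurable_EFinP; exact: measurable_uncovered_integrand.
- by move=> w _; rewrite sumEFin lee_fin sumr_ge0.
- by apply: emeasurable_sum => i; exact/measurable_EFinP.
apply: ge0_le_integral => //.
- by move=> w _; rewrite lee_fin uncovered_integrand_ge0.
- by apply/measurable_EFinP; exact: measurable_uncovered_integrand.
- apply: emeasurable_funD.
    by apply/measurable_EFinP; exact: measurable_uncovered_integrand.
  by apply: emeasurable_sum => i; exact/measurable_EFinP.
move=> w _; rewrite sumEFin -EFinD lee_fin.
rewrite {1}/uncovered_integrand; have [E|_] := boolP (_ < r%:E)%E; last first.
  by rewrite mulr0 addr_ge0 ?uncovered_integrand_ge0// sumr_ge0.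
rewrite mulr1; apply: le_trans (tuple_prodD_le f f1 f2 n w f10 f20 fE) _.
apply: lerD.
  rewrite /uncovered_integrand (_ : (_ < _)%E = true) ?mulr1//.
  (* Replacing [f] by the smaller [f1] only lowers the covered mass, so the event persists. *)
  apply: le_lt_trans E; apply: ge0_le_integral => //.
  - by move=> x _; rewrite lee_fin mulr_ge0.
  - apply/measurable_EFinP; apply: measurable_funM => //.
    by apply: measurable_bool_natr; exact: measurable_coveredr.
  - apply/measurable_EFinP; apply: measurable_funM => //.
    by apply: measurable_bool_natr; exact: measurable_coveredr.
  - by move=> x _; rewrite lee_fin ler_wpM2r// fE lerDl.
apply: ler_sum => i _; rewrite /G.
have [f2i|f2i] := ltP 0 (f2 (tnth w i)); last first.
  by rewrite [f2 _](_ : _ = 0) ?mul0r//; apply/eqP; rewrite eq_le f2i f20.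
rewrite /uncovered_integrand (_ : (_ < _)%E = true) ?mulr1//.
apply: le_lt_trans (covered_mass_delete P h hs f f1 f2 p1 p2 n i w wf1 wf2 fE _) _.
  by move=> x; exact: hle.
by rewrite EFinD lteD2rE.
Qed.

(* A Riemann sum: each of the [k] steps sweeps off a slab of mass [e]. The bound at
   [r + e] and [p + e] absorbs the discretisation error. *)
Lemma uncovered_integral_sweep (h h' : {mfun T >-> R}) hs r e n :
  0 < r -> 0 <= e ->
  (forall f p, weight P f p -> (uncovered_integral P (h' :: hs) f (r + e) n <=
    (sweep_bound (size hs).+1 n (r + e) p)%:E)%E) ->
  forall k f p, weight P f p -> p = k%:R * e ->
  (uncovered_integral P [:: h, h' & hs] f r n.+1 <=
   (sweep_bound (size hs).+2 n.+1 (r + e) (p + e))%:E)%E.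
Proof.
move=> r0 e0 IH; elim => [|k IHk] f p wf pE.
  (* With no slab left the mass is 0, and so is its power [n.+1]. *)
  apply: le_trans (uncovered_integral_le_pow P _ f p r n.+1 wf) _.
  rewrite pE mul0r expr0n /= lee_fin add0r; apply: sweep_bound_ge0 => //.
  by rewrite addr_ge0// ltW.
have kp : 0 <= k%:R * e <= p.
  by rewrite pE mulr_ge0//= ler_wpM2r// ler_nat.
(* [f2] is the slab where [h] is lowest; [f1] holds the [k] slabs above it. *)
have [f1 [f2 [wf1 wf2 fE hle]]] := weight_split h f p _ wf kp.
have pe : p - k%:R * e = e by rewrite pE -natr1; ring.
rewrite pe in wf2.
apply: le_trans (uncovered_integral_split h (h' :: hs) f f1 f2 _ e r n wf1 wf2 fE hle) _.
apply: (@le_trans _ _ ((sweep_bound (size hs).+2 n.+1 (r + e) (k%:R * e + e))%:E +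
  (n.+1%:R * e)%:E * (sweep_bound (size hs).+1 n (r + e) p)%:E)%E).
  apply: leeD; first exact: IHk.
  by apply: lee_wpmul2l; [rewrite lee_fin mulr_ge0|exact: IH].
rewrite -EFinM -EFinD lee_fin.
(* The bound for [f1] is taken one slab above its mass, hence at [p]; the increment from [p] to
   [p + e] then pays for the slab [f2]. *)
have -> : k%:R * e + e = p by rewrite -[RHS](subrK (k%:R * e)) pe addrC.
rewrite addrC -lerBrDr; apply: sweep_bound_increment => //.
  by rewrite addr_ge0// ltW.
exact: weight_ge0 wf.
Qed.

(** Induction on [hs]: one sweep removes one function and one sample point, matching the recursion
    of [sweep_bound]. If [p < r] or [n = 0], the bound by [p ^+ n] is enough. *)
Theorem uncovered_integral_bound hs f p r n : (0 < size hs)%N -> 0 < r ->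
  weight P f p ->
  (uncovered_integral P hs f r n <= (sweep_bound (size hs) n r p)%:E)%E.
Proof.
elim: hs f p r n => // h hs IH f p r n _ r0 wf.
have [pr|rp] := ltP p r.
  by rewrite /sweep_bound pr; exact: uncovered_integral_le_pow.
case: n => [|n].
  by rewrite sweep_bound0 -(expr0 p); exact: uncovered_integral_le_pow.
have p0 : 0 <= p := le_trans (ltW r0) rp.
rewrite /sweep_bound ltNge rp /=.
(* A single function is treated exactly: with [sweep_bound 0] on its left side, the increment
   inequality can fail on a slab that crosses mass [r]. *)
case: hs IH => [|h' hs] IH.
  have := uncovered_integral_single h f p r n.+1 wf; rewrite (ltW r0) rp => /(_ isT).
  move/le_trans; apply; rewrite lee_fin /binomial_head big_ord1 bin0 expr0 !mul1r.
  by rewrite subn0.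
have := uncovered_integral_ge0 P [:: h, h' & hs] f r n.+1.
have [mf f0 fp] := wf => /(_ f0).
have := uncovered_integral_le_pow P [:: h, h' & hs] f p r n.+1 wf.
case E : (uncovered_integral _ _ _ _ _) => [J| |]// _ _.
rewrite lee_fin; apply: le_binomial_head_lim => K.
(* [K.+1] slabs of this mass exhaust [p]; the excess of one slab in both arguments vanishes as [K]
   grows. *)
have e0 : 0 <= p / K.+1%:R by rewrite divr_ge0.
have := uncovered_integral_sweep h h' hs r (p / K.+1%:R) n r0 e0.
move=> /(_ _ K.+1 f p wf); rewrite E lee_fin /sweep_bound ltNge.
rewrite lerD2r rp /=; apply; last by rewrite mulrC divfK// pnatr_eq0.
by move=> g s; apply: IH => //; rewrite ltr_wpDr.
Qed.

End sweeping_bound.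

(** * Application to the scenario program *)

Theorem proposition2 (R : realType) (disp : measure_display)
  (Delta : measurableType disp) (P : probability Delta R)
  (d q N : nat) (hq : (1 <= q)%N) (hN : (1 <= N)%N)
  (X : set 'rV[R]_d) (f : X -> R) (g : X -> 'rV[R]_q) (b : Delta -> 'rV[R]_q)
  (b_meas : forall j : 'I_q,
     measurable_fun [set: Delta] (fun delta => b delta ord0 j))
  (feas : forall M : nat, (1 <= M)%N ->
     {ae product_probability P M,
        forall w, exists x : X, scenario_feasible g b w x})
  (xhat : N.-tuple Delta -> X) (hxhat : suboptimal_solution g b xhat)
  (eps : R) (heps : 0 < eps < 1)
  (V_meas : measurable [set w | (risk g b P (xhat w) <= eps%:E)%E]) :
  ((1 - \sum_(0 <= m < q) ('C(N, m))%:R * eps ^+ m * (1 - eps) ^+ (N - m))%:E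
   <= product_probability P N [set w | risk g b P (xhat w) <= eps%:E])%E.
Proof.
have /andP[eps0 eps1] := heps.
have r0 : 0 < 1 - eps by rewrite subr_gt0.
pose h (j : 'I_q) : {mfun Delta >-> R} := HB.pack (fun delta => b delta ord0 j)
  (isMeasurableFun.Build _ _ _ _ _ (b_meas j)).
pose hs := map h (enum 'I_q).
have size_hs : size hs = q by rewrite size_map size_enum_ord.
(* The sweeping starts from the whole space, with density 1 and mass 1. *)
have w1 : weight P (fun=> 1) 1.
  by split => //; rewrite integral_cst// mul1e; exact: probability_setT.
set B := [set w | _]; set mu := product_probability P N.
pose U := [set w : N.-tuple Delta | (covered_mass P hs (fun=> 1%R) w < (1 - eps)%:E)%E].
have mU : measurable U.
  apply: measurable_true_set; apply: measurable_fun_lte => //.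
  by apply: measurable_covered_mass.
have bound_U : (mu U <= (\sum_(0 <= m < q) 'C(N, m)%:R * eps ^+ m * (1 - eps) ^+ (N - m))%:E)%E.
  have hs0 : (0 < size hs)%N by rewrite size_hs.
  have := uncovered_integral_bound P hs _ _ _ N hs0 r0 w1.
  rewrite /uncovered_integral /uncovered_integrand.
  under eq_integral => w _ do rewrite big1//.
  rewrite (integral_mul_indicator mu (fun=> 1)) integral_cst// mul1e => /le_trans; apply.
  rewrite lee_fin /sweep_bound ifF; last by apply/negbTE; rewrite -leNgt gerBl ltW.
  rewrite size_hs /binomial_head big_mkord ler_sum// => m _.
  by rewrite subKr.
have [A [mA A0 feasA]] := feas N hN.
(* Outside the null set [A] of infeasible data-sets, a risk above [eps] leaves mass below [1 - eps]
   to the satisfied constraints [D], and the covered points lie in [D]. *)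
have sub : ~` B `<=` A `|` U.
  move=> w /negP; rewrite -ltNge => risk_w.
  have [fw|nfw] := pselect (exists x, scenario_feasible g b w x); last first.
    by left; exact: feasA.
  right; have fxw := hxhat _ fw; rewrite /U/=.
  pose D := [set delta | vec_le (g (xhat w)) (b delta)].
  have mD : measurable D.
    rewrite (_ : D = \bigcap_(j in [set: 'I_q])
        [set delta | g (xhat w) ord0 j <= b delta ord0 j]).
      apply: fin_bigcap_measurable => // j _.
      by apply: measurable_true_set; exact: measurable_fun_ler.
    by apply/seteqP; split => delta /= Dd j => [_|]; exact: Dd.
  have PD : (P D < (1 - eps)%:E)%E.
    have -> : P D = (1 - risk g b P (xhat w))%E.
      rewrite -[D in LHS]setCK probability_setC//; exact: measurableC.
    have fin_risk : risk g b P (xhat w) \is a fin_num.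
      exact: (fin_num_measure P _ (measurableC mD)).
    by move: risk_w; rewrite -(fineK fin_risk) -EFinB !lte_fin => ?; lra.
  apply: le_lt_trans PD.
  rewrite /covered_mass (integral_mul_indicator P (fun=> 1)) integral_cst//.
    rewrite mul1e; apply: le_measure; rewrite ?inE//.
      by apply: measurable_true_set; exact: measurable_coveredr.
    (* For each [j] some sample gives [g_j <= b_j(delta_i) <= b_j(delta)]: feasibility, then
       coverage. *)
    move=> delta; rewrite /= /covered all_map => /allP cov j.
    have /has_tnthP[i hi] := cov j (mem_enum _ j).
    exact: le_trans (fxw i j) hi.
  by apply: measurable_true_set; exact: measurable_coveredr.
have : (mu (~` B) <= mu U)%E.
  apply: (@le_trans _ _ (mu (A `|` U))).
    by apply: le_measure; rewrite ?inE//; [exact: measurableC|exact: measurableU].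
  apply: le_trans (measureU2 _ mA mU) _; rewrite [X in (X + _)%E]A0 add0e//.
rewrite probability_setC// => /le_trans /(_ bound_U).
have fin_B : mu B \is a fin_num by exact: fin_num_measure.
by rewrite -(fineK fin_B) -EFinB !lee_fin => ?; lra.
Qed.
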